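(* In the binary model, suppose $\lambda\in(g,1)$, where $g=\frac{\sqrt5-1}{2}$. Then almost surely $S=\mathrm{supp}(\mu)$ has nonempty interior and is the closure of its interior.
   Context: Binary model. Let $T=\{1,2\}^*$ be the set of finite words over $\{1,2\}$ (the rooted binary tree; $v|j$ is the prefix of $v$ of length $j$). Let $\{a_v\}_{v\in T,\,|v|\ge1}$ be i.i.d. random variables with $\mathbb{P}(a_v=0)=\mathbb{P}(a_v=1)=\frac12$. Fix $\lambda\in(0,1)$. For $\omega\in\{1,2\}^{\mathbb{N}}$ put $f(\omega)=\sum_{j\ge1}a_{\omega|j}\lambda^j$. Let $\mu$ be the image under $f$ of the uniform product measure on $\{1,2\}^{\mathbb{N}}$, and $S=f(\{1,2\}^{\mathbb{N}})$ its (random, compact) support. *)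

(* Defs.v *)
From HB Require Import structures.
From mathcomp Require Import all_boot all_order all_algebra.
From mathcomp Require Import all_classical all_reals all_analysis.
Set Implicit Arguments. Unset Strict Implicit. Unset Printing Implicit Defensive.
Import Order.TTheory GRing.Theory Num.Theory.
Import numFieldNormedType.Exports.
Local Open Scope classical_set_scope.
Local Open Scope ring_scope.

(* Binary model.  Words over {1,2} are encoded as [seq bool]
   (false <-> 1, true <-> 2); infinite words omega in {1,2}^N as
   [nat -> bool] (omega 0 is the first letter). *)

Definition prefix (omega : nat -> bool) (j : nat) : seq bool :=
  [seq omega i | i <- iota 0 j].

Definition iid_fair_labels d (T : measurableType d) (R : realType)
    (P : probability T R) (a : seq bool -> T -> bool) : Prop :=
  (forall v, measurable (a v @^-1` [set true])) /\
  forall (s : seq (seq bool)) (b : seq bool -> bool),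
    uniq s -> all (fun v => (0 < size v)%N) s ->
    P (\bigcap_(v in [set` s]) [set t | a v t = b v]) = ((1/2 : R) ^+ size s)%:E.

Definition fbin (R : realType) (T : Type) (a : seq bool -> T -> bool)
    (lambda : R) (t : T) (omega : nat -> bool) : R :=
  limn (series (fun j : nat => (a (prefix omega j.+1) t)%:R * lambda ^+ j.+1)).

Definition Sbin (R : realType) (T : Type) (a : seq bool -> T -> bool)
    (lambda : R) (t : T) : set R :=
  range (fbin a lambda t).

(* Main.v *)
Require Import Defs.
From HB Require Import structures.
From mathcomp Require Import all_boot all_order all_algebra.
From mathcomp Require Import all_classical all_reals all_analysis.
From mathcomp Require Import ring lra.
Set Implicit Arguments.
Unset Strict Implicit.
Unset Printing Implicit Defensive.
Import Order.TTheory GRing.Theory Num.Theory.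
Import numFieldNormedType.Exports.
Local Open Scope classical_set_scope.
Local Open Scope ring_scope.

(* Put [L = lambda / (1 - lambda)].  A node [v] of the tree sees a point [x]
   through its residual [r = (x - psum v) / lambda ^ |v|], which has to lie in
   [[0, L]]; a child labelled [c] has residual [r / lambda - c].  For lambda
   above the golden mean, [1 + lambda < L], and then there is a weight [h]
   (essentially [min (r, L - r, c0)] with [c0] slightly above [lambda]) whose
   expected sum over the two children is at least [rho * h r] with [rho > 1],
   even after an infimum over a small neighbourhood of the residual.  Given
   level [n], the total weight [W_(n+1) x] is a sum of independent bounded
   terms, so by a Chernoff bound [W_(n+1) x >= rho' W_n x] fails with a
   probability that is exponentially small in [W_n x].  With thresholds growing
   like [rho' ^ n] these probabilities, summed over a mesh of [O(lambda ^- n)]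
   points, are summable, and Borel-Cantelli leaves no failure beyond some level
   [m].  At level [m] a pigeonhole argument ([2 * lambda > 1]) gives an interval
   on which [W_m] exceeds the threshold; the weights then stay positive on a
   smaller interval, which is therefore contained in the compact set [S].
   Applied to all subtrees, this gives interior points in every cylinder of [S],
   hence the second claim. *)

(** * A weight growing under the two inverse branches *)

Section Weight.
Variables (R : realFieldType) (lam L gam : R).

(** [L] is the sum of all [lam ^ j] with [j >= 1]. The last field quantifies [1 + lam < L], which is
    the golden-mean condition [lam + lam ^ 2 > 1]. *)
Record admissible : Prop := Admissible {
  lam_gt : 1 / 2 < lam;
  gam_gt0 : 0 < gam;
  LE : L * (1 - lam) = lam;
  gam_lam : lam + 4 * gam <= 1;
  gam_L : lam + 4 * gam <= L - 1 }.

Definition margin : R := gam ^+ 2 / 2.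

Definition tent (x : R) : R := Num.min (Num.min x (L - x)) (lam + 2 * gam).

(** The cutoff ensures [margin = gam * (gam / 2) <= gam * x] wherever the weight is nonzero, so the
    absolute loss [margin] is paid for by a relative gain. *)
Definition weight (x : R) : R :=
  if (gam / 2 <= x) && (x <= L - gam / 2) then tent x else 0.

(** The tent is 1-Lipschitz, so this bounds [weight] from below on the whole [margin]-neighbourhood
    of [x]. *)
Definition inner_weight (x : R) : R :=
  if (gam / 2 + margin <= x) && (x <= L - gam / 2 - margin)
  then tent x - margin else 0.

Lemma tentP x y :
  (y <= tent x) = [&& y <= x, y <= L - x & y <= lam + 2 * gam].
Proof. by rewrite /tent !le_min andbA. Qed.

Lemma tent_le x :
  [/\ tent x <= x, tent x <= L - x & tent x <= lam + 2 * gam].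
Proof. by have := lexx (tent x); rewrite {1}tentP => /and3P[]. Qed.

Hypothesis adm : admissible.

Lemma gam_le : gam <= 1 / 8.
Proof.
have [lg g0 LE gl gL] := adm.
lra.
Qed.

Lemma margin_gt0 : 0 < margin.
Proof.
have [lg g0 LE gl gL] := adm.
by rewrite /margin divr_gt0 // exprn_gt0.
Qed.

Lemma margin_le : margin <= gam / 16.
Proof.
have [lg g0 LE gl gL] := adm.
by rewrite /margin expr2; have := gam_le => g; nra.
Qed.

Lemma weight_ge0 x : 0 <= weight x.
Proof.
have [lg g0 LE gl gL] := adm.
rewrite /weight; case: ifP => // /andP[a b]; rewrite tentP; lra.
Qed.

Lemma weight_gt0_bounds x : 0 < weight x -> 0 <= x <= L.
Proof.
have [lg g0 LE gl gL] := adm.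
rewrite /weight; case: ifP => [/andP[a b]|]; lra.
Qed.

Lemma weight_center x : L / 2 - 1 / 4 <= x <= L / 2 + 1 / 4 -> 1 / 2 <= weight x.
Proof.
have [lg g0 LE gl gL] := adm.
move=> /andP[a b]; have := gam_le => g8; rewrite /weight ifT; last first.
  by apply/andP; split; lra.
rewrite tentP; lra.
Qed.

Lemma inner_weight_ge0 x : 0 <= inner_weight x.
Proof.
have [lg g0 LE gl gL] := adm.
have := margin_gt0; have := margin_le => ml m0.
rewrite /inner_weight; case: ifP => // /andP[a b].
rewrite subr_ge0 tentP; lra.
Qed.

Lemma inner_weight_le1 x : inner_weight x <= 1.
Proof.
have [lg g0 LE gl gL] := adm.
have := margin_gt0 => m0; rewrite /inner_weight.
by case: ifP => _; [have [] := tent_le x|]; lra.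
Qed.

Lemma inner_weight_le x y : x - y <= margin -> y - x <= margin ->
  inner_weight x <= weight y.
Proof.
have [lg g0 LE gl gL] := adm.
move=> xy yx; rewrite {1}/inner_weight; case: ifP => [/andP[a b]|_].
  rewrite /weight ifT; last by apply/andP; split; lra.
  have [t1 t2 t3] := tent_le x; have := margin_gt0 => m0.
  by rewrite tentP; apply/and3P; split; lra.
exact: weight_ge0.
Qed.

Lemma inner_weight_ge y z : gam / 2 + margin <= y -> y <= L - gam / 2 - margin ->
  z + margin <= y -> z + margin <= L - y -> z + margin <= lam + 2 * gam ->
  z <= inner_weight y.
Proof.
have [lg g0 LE gl gL] := adm.
move=> a b h1 h2 h3; rewrite /inner_weight ifT; last by apply/andP.
by rewrite lerBrDr tentP; apply/and3P.
Qed.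

Lemma inner_weight_sym x : inner_weight (L - x) = inner_weight x.
Proof.
have [lg g0 LE gl gL] := adm.
have ts : tent (L - x) = tent x.
  by rewrite /tent (minC (L - x)); congr (Num.min (Num.min _ _) _); lra.
rewrite /inner_weight ts andbC; congr (if _ && _ then _ else _);
  by apply/idP/idP; lra.
Qed.

Lemma weight_sym x : weight (L - x) = weight x.
Proof.
have [lg g0 LE gl gL] := adm.
have ts : tent (L - x) = tent x.
  by rewrite /tent (minC (L - x)); congr (Num.min (Num.min _ _) _); lra.
rewrite /weight ts andbC; congr (if _ && _ then _ else _);
  by apply/idP/idP; lra.
Qed.

(** Up to [lam + gam] the label-0 child suffices, since dividing by [lam] expands by at least
    [1 + 4 * gam]. Beyond that both children count: with [y = x / lam], the distances [L - y] and
    [y - 1] add up to [L - 1], which exceeds the cap [lam + 2 * gam] by at least [2 * gam]. *)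
Lemma weight_growth_left x : x <= L / 2 ->
  (1 + gam / 4) * weight x <= inner_weight (x / lam) + inner_weight (x / lam - 1).
Proof.
have [lg g0 LE gl gL] := adm.
move=> xL; have lam0 : 0 < lam by lra.
have g8 := gam_le; have m0 := margin_gt0; have ml := margin_le.
have i1 := inner_weight_ge0 (x / lam - 1).
have i0 := inner_weight_ge0 (x / lam).
rewrite /weight; case: ifP => [/andP[gx _]|_]; last by rewrite mulr0; lra.
have [t1 _ t3] := tent_le x.
set y := x / lam in i0 i1 *; have xE : x = y * lam by rewrite /y; field; lra.
have y0 : 0 <= y by rewrite /y divr_ge0 //; lra.
have y1l : 4 * gam * y <= (1 - lam) * y by rewrite ler_wpM2r //; lra.
have yx : x + 4 * gam * x <= y.
  have : x <= y by nra.
  by move=> ?; have : gam * x <= gam * y; [rewrite ler_wpM2l //; lra|lra].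
have [xl|xl] := leP x (lam + gam).
  apply: (@le_trans _ _ ((1 + gam / 4) * x)).
    by rewrite ler_wpM2l //; lra.
  rewrite -[leLHS]addr0 lerD //.
  have yl : y <= 1 + 2 * gam by nra.
  have gx2 : margin <= gam * x by rewrite /margin; nra.
  have gx3 : gam * x <= gam * 1 by nra.
  by apply: inner_weight_ge; nra.
have y1 : 1 + gam <= y by nra.
(* Since [L / lam = L + 1], the hypothesis [x <= L / 2] amounts to [y - 1 <= L - y]. *)
have yl : y <= (L + 1) / 2.
  have -> : (L + 1) / 2 = (L / 2) / lam.
    have h : L = (L + 1) * lam by lra.
    by rewrite {2}h; field; lra.
  by rewrite /y ler_wpM2r ?invr_ge0 //; lra.
have gt : gam * tent x <= gam * 1 by nra.
have [y2|y2] := leP (L - y) (lam + 2 * gam).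
  have h1 : L - y - margin <= inner_weight y by apply: inner_weight_ge; lra.
  have [y3|y3] := leP (y - 1) (lam + 2 * gam).
    have h2 : y - 1 - margin <= inner_weight (y - 1) by apply: inner_weight_ge; lra.
    by nra.
  have h2 : lam + 2 * gam - margin <= inner_weight (y - 1).
    by apply: inner_weight_ge; lra.
  nra.
(* The label-0 child already reaches the cap, and [y - 1 >= gam] supplies the surplus. *)
have h1 : lam + 2 * gam - margin <= inner_weight y by apply: inner_weight_ge; lra.
have h2 : gam - margin <= inner_weight (y - 1) by apply: inner_weight_ge; lra.
nra.
Qed.

(* The reflection [x |-> L - x] exchanges the two branches [x / lam] and
   [x / lam - 1], so the case [x <= L / 2] suffices. *)
Lemma weight_growth x :
  (1 + gam / 4) * weight x <= inner_weight (x / lam) + inner_weight (x / lam - 1).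
Proof.
have [lg g0 LE gl gL] := adm.
have [xL|xL] := leP x (L / 2); first exact: weight_growth_left.
rewrite -(weight_sym x) -(inner_weight_sym (x / lam)) -(inner_weight_sym (x / lam - 1)).
have E : L = (L + 1) * lam by lra.
have E1 : (L - x) / lam = L + 1 - x / lam by rewrite {1}E; field; lra.
have -> : L - (x / lam - 1) = (L - x) / lam by rewrite E1; lra.
have -> : L - x / lam = (L - x) / lam - 1 by rewrite E1; lra.
rewrite [leRHS]addrC; apply: weight_growth_left; lra.
Qed.

End Weight.

(** * Words, partial sums and the level [m] pigeonhole *)

Section Words.

Fixpoint words (n : nat) : seq (seq bool) :=
  if n is m.+1 then [seq rcons u i | u <- words m, i <- [:: false; true]]
  else [:: [::]].

Lemma mem_words n v : (v \in words n) = (size v == n).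
Proof.
elim: n v => [|n IH] v; first by rewrite inE size_eq0.
apply/allpairsP/eqP => [[[u i] [/= + _ ->]]|].
  by rewrite IH size_rcons => /eqP ->.
case/lastP: v => // u i; rewrite size_rcons => -[sz].
by exists (u, i); split => //=; [rewrite IH sz|case: i].
Qed.

Lemma uniq_words n : uniq (words n).
Proof.
elim: n => // n IH; apply: allpairs_uniq => // -[u i] [v j] _ _ /=.
by move=> /rcons_inj.
Qed.

Lemma size_words n : size (words n) = (2 ^ n)%N.
Proof. by elim: n => // n IH; rewrite size_allpairs IH expnSr. Qed.

Lemma sum_words (V : nmodType) n (F : seq bool -> V) :
  \sum_(v <- words n.+1) F v =
  \sum_(u <- words n) (F (rcons u false) + F (rcons u true)).
Proof.
rewrite big_allpairs_dep; apply: eq_bigr => u _.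
by rewrite !big_cons big_nil /= addr0.
Qed.

Arguments words : simpl never.

(** The deepest level comes first, so [labels n.+1] is by computation the fresh labels followed by
    the ones already revealed. *)
Fixpoint labels (n : nat) : seq (seq bool) :=
  if n is m.+1 then words m.+1 ++ labels m else [::].

Lemma mem_labels n v : (v \in labels n) = (0 < size v <= n)%N.
Proof.
elim: n => [|n IH] /=; first by rewrite inE; case: (size v).
rewrite mem_cat mem_words IH.
by rewrite (leq_eqVlt (size v) n.+1) ltnS; case: eqP => [->|].
Qed.

Lemma uniq_labels n : uniq (labels n).
Proof.
elim: n => // n IH; rewrite /= cat_uniq IH andbT uniq_words /=.
apply/hasPn => v; rewrite mem_labels mem_words => /andP[_ h].
by rewrite neq_ltn ltnS h.
Qed.

End Words.

Section PartialSums.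
Variables (R : realType) (lam L : R).

Definition psum (b : seq bool -> bool) (v : seq bool) : R :=
  \sum_(j < size v) (b (take j.+1 v))%:R * lam ^+ j.+1.

Definition residual b (x : R) v := (x - psum b v) / lam ^+ size v.

Definition total (h : R -> R) b n x := \sum_(v <- words n) h (residual b x v).

Lemma psum_eq b b' v :
  (forall w, (0 < size w <= size v)%N -> b w = b' w) -> psum b v = psum b' v.
Proof.
move=> bb; apply: eq_bigr => j _; rewrite bb //.
by rewrite size_takel ltn_ord.
Qed.

Lemma residual_eq b b' x v :
  (forall w, (0 < size w <= size v)%N -> b w = b' w) ->
  residual b x v = residual b' x v.
Proof. by move=> bb; rewrite /residual (psum_eq bb). Qed.

Lemma total_eq h b b' n x :
  (forall w, w \in labels n -> b w = b' w) -> total h b n x = total h b' n x.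
Proof.
move=> bb; rewrite /total big_seq [RHS]big_seq; apply: eq_bigr => v.
rewrite mem_words => /eqP vn; congr h; apply: residual_eq => w.
by rewrite vn -mem_labels; exact: bb.
Qed.

Lemma psum_rcons b u i :
  psum b (rcons u i) = psum b u + (b (rcons u i))%:R * lam ^+ (size u).+1.
Proof.
rewrite /psum size_rcons big_ord_recr /=; congr (_ + _); last first.
  by rewrite take_oversize // size_rcons.
apply: eq_bigr => j _; congr ((b _)%:R * _).
by rewrite -cats1 takel_cat.
Qed.

Hypothesis lam01 : 0 < lam < 1.
Hypothesis LE : L * (1 - lam) = lam.

Lemma residual_rcons b x u i :
  residual b x (rcons u i) = residual b x u / lam - (b (rcons u i))%:R.
Proof.
have /andP[l0 _] := lam01.
rewrite /residual psum_rcons size_rcons exprS.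
have : lam ^+ size u != 0 by rewrite expf_neq0 // gt_eqF.
by move=> h; field; rewrite h gt_eqF.
Qed.

Lemma psum_ge0 b v : 0 <= psum b v.
Proof.
have /andP[l0 _] := lam01.
by apply: sumr_ge0 => j _; rewrite mulr_ge0 // exprn_ge0 // ltW.
Qed.

Lemma psum_le b v : psum b v <= L.
Proof.
have /andP[l0 l1] := lam01; have lE := LE.
have L0 : 0 < L by nra.
(* The induction needs room for the remaining tail, which is at most [L * lam ^+ size v]. *)
suff : psum b v <= L - L * lam ^+ size v.
  move=> /le_trans; apply; rewrite gerBl mulr_ge0 ?exprn_ge0 //; lra.
elim/last_ind: v => [|u i IH]; first by rewrite /psum big_ord0 expr0; lra.
rewrite psum_rcons size_rcons exprS.
have p0 : 0 < lam ^+ size u by rewrite exprn_gt0.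
have : (b (rcons u i))%:R * (lam * lam ^+ size u) <= lam * lam ^+ size u.
  by rewrite ler_piMl ?mulr_ge0 ?(ltW l0) ?(ltW p0) // lern1 leq_b1.
have : L * lam ^+ size u = (L * lam + lam) * lam ^+ size u.
  by congr (_ * _); lra.
lra.
Qed.

Lemma total_le h h' m b n x y :
  (forall u v, u - v <= m -> v - u <= m -> h u <= h' v) ->
  `|x - y| <= m * lam ^+ n -> total h b n x <= total h' b n y.
Proof.
move=> hh xy; rewrite /total big_seq [leRHS]big_seq; apply: ler_sum => v.
rewrite mem_words => /eqP vn; have /andP[l0 _] := lam01.
have p0 : 0 < lam ^+ n by rewrite exprn_gt0.
move: xy; rewrite ler_norml => /andP[xy yx].
apply: hh; rewrite /residual vn -mulrBl ler_pdivrMr //; lra.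
Qed.

End PartialSums.

Lemma pigeonhole (T : eqType) (s : seq T) (f : T -> nat) N : (0 < N)%N ->
  (forall v, v \in s -> f v < N)%N ->
  exists2 j, (j < N)%N & (size s <= N * count (fun v => f v == j) s)%N.
Proof.
move=> N0 fN; pose c (j : 'I_N) := count (fun v => f v == j) s.
have [|j jE] := @bigop.eq_bigmax _ c; first by rewrite card_ord.
exists j => //; rewrite -/(c j) -jE.
have -> : size s = \sum_(j < N) c j.
  under eq_bigr do rewrite /c -sum1_count big_mkcond.
  rewrite exchange_big /= -sum1_size big_seq [RHS]big_seq.
  apply: eq_bigr => v vs; rewrite (bigD1 (Ordinal (fN v vs))) //= eqxx big1 //.
  by move=> i; rewrite -val_eqE /= eq_sym => /negbTE ->.
have -> : (N * \max_(i < N) c i = \sum_(j < N) \max_(i < N) c i)%N.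
  by rewrite sum_nat_const card_ord.
by apply: leq_sum => i _; exact: bigop.leq_bigmax.
Qed.

Section Start.
Variables (R : realType) (lam L gam : R).
Hypothesis adm : admissible lam L gam.

(* The [2 ^ m] partial sums at level [m] lie in an interval that is covered by
   [O(lam ^- m)] cells of length [lam ^ m / 8], and [2 * lam > 1]. *)
Lemma total_weight_start b m : exists2 x0 : R,
  lam ^+ m * (L / 2) <= x0 <= 3 / 2 * L &
  forall x, `|x - x0| <= lam ^+ m / 8 ->
    (2 * lam) ^+ m / (2 * (8 * L + 1)) <= total lam (weight lam L gam) b m x.
Proof.
have [lg g0 LE gl gL] := adm.
have lam01 : 0 < lam < 1 by apply/andP; split; lra.
have p0 : 0 < lam ^+ m by rewrite exprn_gt0 //; lra.
have p1 : lam ^+ m <= 1 by rewrite exprn_ile1 //; lra.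
pose q v := psum lam b v / lam ^+ m.
have q0 v : 0 <= q v by rewrite divr_ge0 ?psum_ge0 // ltW.
pose bin v := Num.truncn (8 * q v).
have binP v : (bin v)%:R <= 8 * q v < (bin v).+1%:R.
  by apply: truncn_itv; rewrite mulr_ge0.
pose N := (Num.truncn (8 * (L / lam ^+ m))).+1.
have L0 : 0 < L by lra.
have NP : N%:R <= (8 * L + 1) / lam ^+ m.
  have : (Num.truncn (8 * (L / lam ^+ m)))%:R <= 8 * (L / lam ^+ m).
    by rewrite truncn_le mulr_ge0 // divr_ge0 // ltW.
  rewrite /N -natr1 => h.
  have : 1 <= 1 / lam ^+ m by rewrite ler_pdivlMr // mul1r.
  lra.
have [||j jN jc] := @pigeonhole _ (words m) bin N; first by [].
  move=> v _; rewrite ltnS; apply: le_truncn.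
  by rewrite ler_pM2l // ler_pM2r ?invr_gt0 //; apply: psum_le => //; lra.
(* With this centre, every node of cell [j] has residual within [1 / 4] of [L / 2]: [1 / 8] from the
   cell and [1 / 8] from [x]. *)
exists (lam ^+ m * (j%:R / 8 + L / 2)).
  rewrite ler_pM2l // lerDr divr_ge0 //=.
  (* The popular cell is nonempty, and a partial sum in it is at most [L]; this bounds [x0]
     above. *)
  have /hasP[v _ /eqP bv] : has (fun v => bin v == j) (words m).
    rewrite has_count lt0n; apply: contraL jc => /eqP ->.
    by rewrite muln0 size_words -ltnNge expn_gt0.
  have /andP[+ _] := binP v; rewrite bv => jq.
  have : j%:R / 8 <= psum lam b v / lam ^+ m by rewrite -/(q v); lra.
  rewrite ler_pdivlMr // => h1.
  have h2 := psum_le lam01 LE b v.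
  have : lam ^+ m * (L / 2) <= L / 2 by rewrite ler_piMl //; lra.
  lra.
move=> x xx0; apply: (@le_trans _ _ (\sum_(v <- words m | bin v == j) (1 / 2))).
  rewrite big_const_seq iter_addr_0 -[leRHS]mulr_natr.
  have cN : 2 ^+ m <= N%:R * (count (fun v => bin v == j) (words m))%:R :> R.
    by rewrite -natrM -natrX ler_nat -size_words.
  rewrite exprMn; set c := (count _ _)%:R in cN *.
  have c0 : 0 <= c :> R by rewrite /c.
  rewrite ler_pdivrMr; last lra.
  have : N%:R * c <= (8 * L + 1) / lam ^+ m * c by rewrite ler_wpM2r.
  move=> /(le_trans cN); rewrite mulrAC ler_pdivlMr // => h.
  have -> : 1 / 2 * c * (2 * (8 * L + 1)) = (8 * L + 1) * c by field.
  exact: h.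
rewrite /total [leRHS](bigID (fun v => bin v == j)) /= -[leLHS]addr0 lerD //; last first.
  by apply: sumr_ge0 => v _; exact: weight_ge0.
rewrite big_seq_cond [leRHS]big_seq_cond; apply: ler_sum => v.
rewrite mem_words => /andP[/eqP vm /eqP bv]; apply: weight_center => //.
have := binP v; rewrite bv -natr1 /residual vm mulrBl -/(q v) => /andP[j1 j2].
have : `|x / lam ^+ m - (j%:R / 8 + L / 2)| <= 1 / 8.
  have -> : x / lam ^+ m - (j%:R / 8 + L / 2) =
     (x - lam ^+ m * (j%:R / 8 + L / 2)) / lam ^+ m by field; rewrite gt_eqF.
  rewrite normrM [X in _ * X]gtr0_norm ?invr_gt0 //.
  by rewrite ler_pdivrMr //; lra.
by rewrite ler_norml => /andP[? ?]; apply/andP; split; lra.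
Qed.

End Start.

(** * Chernoff bound for the labels *)

Section Concentration.
Variables (d : measure_display) (T : measurableType d) (R : realType).
Variables (P : probability T R) (a : seq bool -> T -> bool).
Hypothesis iid : iid_fair_labels P a.

Definition cylinder (s : seq (seq bool)) (b : seq bool -> bool) : set T :=
  \bigcap_(v in [set` s]) [set t | a v t = b v].

(** Measurability travels with the bound because both come from the same finite splitting into
    cylinders. *)
Definition prob_le (A : set T) (p : R) := measurable A /\ (P A <= p%:E)%E.

Lemma measurable_label v c : measurable [set t | a v t = c].
Proof.
case: c; first exact: iid.1.
have -> : [set t | a v t = false] = ~` (a v @^-1` [set true]).
  by apply/seteqP; split=> t /=; case: (a v t).
by apply: measurableC; exact: iid.1.
Qed.

Lemma measurable_cylinder s b : measurable (cylinder s b).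
Proof.
rewrite /cylinder bigcap_seq; apply: bigsetI_measurable => v _.
exact: measurable_label.
Qed.

Lemma cylinder_split s b u E : u \notin s ->
  cylinder s b `&` E =
  (cylinder (u :: s) (fun v => if v == u then false else b v) `&` E) `|`
  (cylinder (u :: s) (fun v => if v == u then true else b v) `&` E).
Proof.
move=> us.
have vu v : v \in s -> (v == u) = false.
  by move=> vs; apply/negP => /eqP vE; rewrite -vE vs in us.
apply/seteqP; split=> t.
  move=> [bt Et]; case E0: (a u t); [right|left]; split=> // v /=;
  rewrite inE => /orP[/eqP ->|vs]; rewrite ?eqxx ?vu //; exact: bt.
by move=> [] [bt Et]; split=> // v /= vs; have /= := bt v;
  rewrite inE vs orbT vu //; apply.
Qed.

Lemma prob_le_split s b u E p q : u \notin s ->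
  prob_le (cylinder (u :: s) (fun v => if v == u then false else b v) `&` E) p ->
  prob_le (cylinder (u :: s) (fun v => if v == u then true else b v) `&` E) q ->
  prob_le (cylinder s b `&` E) (p + q).
Proof.
move=> us [m1 p1] [m2 p2]; rewrite (cylinder_split _ _ us).
split; first exact: measurableU.
apply: (le_trans (measureU2 _ m1 m2)).
by rewrite EFinD leeD.
Qed.

(** Conditioning on the labels in [s]: each pattern has probability [2 ^- size s], so [p] bounds
    every conditional probability and hence their average. *)
Lemma prob_le_cylinders s E p : uniq s ->
  (forall b, prob_le (cylinder s b `&` E) (p / 2 ^+ size s)) -> prob_le E p.
Proof.
elim: s => [_ /(_ xpredT)|u s IH /= /andP[us ss] H].
  rewrite expr0 divr1 /cylinder.
  have -> : [set` [::]] = set0 :> set (seq bool) by apply/seteqP; split.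
  by rewrite bigcap_set0 setTI.
apply: IH => // b.
have -> : p / 2 ^+ size s = p / 2 ^+ (size s).+1 + p / 2 ^+ (size s).+1.
  rewrite exprS.
  have : 2 ^+ size s != 0 :> R by rewrite expf_neq0.
  by move=> h; field; rewrite h.
by apply: prob_le_split us _ _; exact: H.
Qed.

(** The exponential Markov inequality, proved by revealing the labels of [s2] one at a time. The
    value [c] at [u] lowers the target [theta] by [g u c], and averaging over both values yields one
    factor; [s1] holds the labels already fixed. *)
Lemma prob_le_chernoff (s : R) (g : seq bool -> bool -> R) s2 s1 b theta :
  uniq (s2 ++ s1) -> all (fun v => 0 < size v)%N (s2 ++ s1) -> 0 <= s ->
  prob_le (cylinder s1 b `&` [set t | \sum_(u <- s2) g u (a u t) < theta])
    (expR (s * theta) *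
     (\prod_(u <- s2) ((expR (- (s * g u false)) + expR (- (s * g u true))) / 2))
     / 2 ^+ size s1).
Proof.
move=> + + s0; elim: s2 s1 b theta => [|u s2 IH] s1 b theta.
  rewrite cat0s => us1 as1; rewrite big_nil mulr1.
  (* Once all labels are fixed the sum is empty: the event is the whole cylinder if [0 < theta],
     where [expR (s * theta) >= 1], and is empty otherwise. *)
  have [th|th] := ltP 0 theta.
    have -> : [set t | \sum_(u <- [::]) g u (a u t) < theta] = setT :> set T.
      by apply/seteqP; split=> // t _ /=; rewrite big_nil.
    rewrite setIT; split; first exact: measurable_cylinder.
    rewrite iid.2 // lee_fin expr_div_n expr1n ler_pM2r ?invr_gt0 ?exprn_gt0 //.
    by rewrite -expR0 ler_expR mulr_ge0 // ltW.
  have -> : [set t | \sum_(u <- [::]) g u (a u t) < theta] = set0 :> set T.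
    by apply/seteqP; split=> // t /=; rewrite big_nil ltNge th.
  rewrite setI0; split=> //.
  by rewrite measure0 lee_fin divr_ge0 ?expR_ge0 ?exprn_ge0.
move=> uu aa.
have us : u \notin s1 by move: uu => /= /andP[]; rewrite mem_cat negb_or => /andP[].
have pe : perm_eq (s2 ++ u :: s1) ((u :: s2) ++ s1).
  by rewrite perm_sym -cat1s -catA perm_catCA.
have step c := IH (u :: s1) (fun v => if v == u then c else b v) (theta - g u c)
   ltac:(by rewrite (perm_uniq pe)) ltac:(by rewrite (perm_all _ pe)).
have setE c : cylinder (u :: s1) (fun v => if v == u then c else b v) `&`
    [set t | \sum_(v <- u :: s2) g v (a v t) < theta] =
    cylinder (u :: s1) (fun v => if v == u then c else b v) `&`
    [set t | \sum_(v <- s2) g v (a v t) < theta - g u c].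
  apply/seteqP; split=> t [ct] /=; rewrite big_cons;
  have /= := ct u; rewrite inE eqxx => -> //=; rewrite ltrBrDr addrC //.
pose pr := \prod_(v <- s2) ((expR (- (s * g v false)) + expR (- (s * g v true))) / 2).
have -> : expR (s * theta) * (\prod_(v <- u :: s2)
     ((expR (- (s * g v false)) + expR (- (s * g v true))) / 2)) / 2 ^+ size s1 =
   expR (s * (theta - g u false)) * pr / 2 ^+ size (u :: s1) +
   expR (s * (theta - g u true)) * pr / 2 ^+ size (u :: s1).
  rewrite big_cons -/pr /= exprS !mulrBr !expRD.
  have : 2 ^+ size s1 != 0 :> R by rewrite expf_neq0.
  by move=> h; field; rewrite h.
by apply: prob_le_split us _ _; rewrite setE; exact: step.
Qed.

(** From [expR (s * y) >= 1 + s * y] and [y * y <= y]. Being affine in [y], the bound lets only the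
    mean of each term enter the Chernoff product. *)
Lemma expR_chord (s y : R) : 0 <= s <= 1 -> 0 <= y <= 1 ->
  expR (- (s * y)) <= 1 - (s - s ^+ 2) * y.
Proof.
move=> /andP[s0 s1] /andP[y0 y1].
have sy0 : 0 <= s * y by rewrite mulr_ge0.
apply: (@le_trans _ _ (1 + s * y)^-1).
  rewrite expRN lef_pV2 ?posrE ?expR_gt0 ?expR_ge1Dx //; lra.
rewrite -[leLHS]mul1r ler_pdivrMr; last lra.
have h1 : y * y <= y by nra.
have h2 : s * s * (y * y) <= s * s * y by rewrite ler_wpM2l ?mulr_ge0.
have h3 : 0 <= s * s * s * (y * y) by rewrite !mulr_ge0.
rewrite expr2; nra.
Qed.

Lemma chernoff_prod_le (s : R) (g : seq bool -> bool -> R) s2 : 0 <= s <= 1 ->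
  (forall u c, 0 <= g u c <= 1) ->
  \prod_(u <- s2) ((expR (- (s * g u false)) + expR (- (s * g u true))) / 2) <=
  expR (- ((s - s ^+ 2) * \sum_(u <- s2) ((g u false + g u true) / 2))).
Proof.
move=> s01 g01; rewrite mulr_sumr -sumrN expR_sum; apply: ler_prod => u _.
apply/andP; split; first by rewrite divr_ge0 // addr_ge0 // expR_ge0.
have h1 := expR_chord s01 (g01 u false).
have h2 := expR_chord s01 (g01 u true).
apply: le_trans (expR_ge1Dx _); lra.
Qed.

Variables (lam L gam : R).
Hypothesis adm : admissible lam L gam.

(** Level [n.+1] is measured by [inner_weight], so that success at [x] carries over to [weight] at
    nearby points. The rate keeps half of the gain [gam / 4] of [weight_growth] and leaves the rest
    for the deviation. *)
Definition failure n x z : set T :=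
  [set t | z <= total lam (weight lam L gam) (a ^~ t) n x /\
           total lam (inner_weight lam L gam) (a ^~ t) n.+1 x < (1 + gam / 8) * z].

Lemma failure_prob_le n x z : 0 <= z ->
  prob_le (failure n x z) (expR (- (gam ^+ 2 / 512 * z))).
Proof.
move=> z0; have [lg g0 LE gl gL] := adm.
have g8 := gam_le adm.
have lam01 : 0 < lam < 1 by apply/andP; split; lra.
apply: (prob_le_cylinders (uniq_labels n)) => b.
have [bz|bz] := leP z (total lam (weight lam L gam) b n x); last first.
  have -> : cylinder (labels n) b `&` failure n x z = set0.
    apply/seteqP; split=> // t [bt [+ _]].
    by rewrite (@total_eq _ _ _ _ b) ?leNgt ?bz // => v /bt.
  split=> //; rewrite measure0 lee_fin divr_ge0 ?expR_ge0 ?exprn_ge0 //.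
pose r u := residual lam b x (take n u) / lam.
pose g u (c : bool) := inner_weight lam L gam (r u - c%:R).
have -> : cylinder (labels n) b `&` failure n x z =
    cylinder (labels n) b `&`
    [set t | \sum_(u <- words n.+1) g u (a u t) < (1 + gam / 8) * z].
  have E t : cylinder (labels n) b t ->
      total lam (inner_weight lam L gam) (a ^~ t) n.+1 x =
      \sum_(u <- words n.+1) g u (a u t).
    move=> bt; rewrite /total big_seq [RHS]big_seq; apply: eq_bigr => u.
    rewrite mem_words; case/lastP: u => // w i; rewrite size_rcons => /eqP[wn].
    rewrite residual_rcons // /g /r -wn -cats1 take_size_cat //.
    rewrite (@residual_eq _ _ _ b) // => v; rewrite wn -mem_labels; exact: bt.
  apply/seteqP; split=> t [bt] /=.
    by move=> [_ h]; split=> //; rewrite -E.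
  move=> h; split=> //; split; last by rewrite E.
  by rewrite (@total_eq _ _ _ _ b) // => v /bt.
have g01 u c : 0 <= g u c <= 1.
  by rewrite inner_weight_ge0 ?inner_weight_le1.
have uE : uniq (words n.+1 ++ labels n) by exact: (uniq_labels n.+1).
have aE : all (fun v => 0 < size v)%N (words n.+1 ++ labels n).
  apply/allP => v; rewrite -[_ ++ _]/(labels n.+1) mem_labels.
  by move=> /andP[].
(* With [s = gam / 32] the exponent [s * (1 + gam / 8) * z - (s - s ^ 2) * (1 + gam / 4) * z] falls
   below [- gam ^ 2 / 512 * z]. *)
have s01 : 0 <= gam / 32 <= 1 by apply/andP; split; lra.
have [//|mE PE] := @prob_le_chernoff (gam / 32) g _ _ b ((1 + gam / 8) * z) uE aE.
  by case/andP: s01.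
split=> //; apply: (le_trans PE); rewrite lee_fin.
rewrite ler_pM2r ?invr_gt0 ?exprn_gt0 //.
apply: le_trans (ler_wpM2l (expR_ge0 _) (chernoff_prod_le _ s01 g01)) _.
rewrite -expRD ler_expR.
have sumE : (1 + gam / 4) * z <=
    \sum_(u <- words n.+1) ((g u false + g u true) / 2).
  apply: le_trans (_ : (1 + gam / 4) * total lam (weight lam L gam) b n x <= _).
    by rewrite ler_wpM2l //; lra.
  rewrite sum_words /total mulr_sumr big_seq [leRHS]big_seq.
  apply: ler_sum => w; rewrite mem_words => /eqP wn.
  have gE i c : g (rcons w i) c =
      inner_weight lam L gam (residual lam b x w / lam - c%:R).
    by rewrite /g /r -wn -cats1 take_size_cat.
  have := weight_growth adm (residual lam b x w).
  rewrite !gE subr0; lra.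
set M := \sum_(u <- words n.+1) _ in sumE *.
have s2 : 0 <= gam / 32 - (gam / 32) ^+ 2 by rewrite expr2; nra.
have := ler_wpM2l s2 sumE.
have gz : 0 <= gam * z by rewrite mulr_ge0 // ltW.
have ggz : 0 <= gam * (gam * z) by rewrite mulr_ge0 // ltW.
have gggz : gam * (gam * (gam * z)) <= 1 / 8 * (gam * (gam * z)).
  by rewrite ler_wpM2r.
rewrite !expr2; lra.
Qed.

End Concentration.

(** * The set of sums *)

Section Support.
Variables (R : realType) (T : Type) (lam L : R).
Implicit Types (a : seq bool -> T -> bool) (t : T) (omega : nat -> bool).

Lemma geometric_small (C e : R) : 0 < lam < 1 -> 0 < e ->
  exists n, C * lam ^+ n < e.
Proof.
move=> /andP[l0 l1] e0.
have : geometric C lam n @[n --> \oo] --> (0 : R).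
  by apply: cvg_geometric; rewrite gtr0_norm.
move=> /cvgrPdist_lt /(_ e e0) [N _ /(_ N (leqnn N))] /=.
rewrite sub0r normrN => h; exists N; exact: le_lt_trans (ler_norm _) h.
Qed.

Lemma size_prefix omega n : size (Defs.prefix omega n) = n.
Proof. by rewrite size_map size_iota. Qed.

Lemma prefixD omega n k : Defs.prefix omega (n + k) =
  Defs.prefix omega n ++ Defs.prefix (fun i => omega (n + i)%N) k.
Proof.
rewrite /Defs.prefix iotaD map_cat add0n; congr (_ ++ _).
by rewrite -{1}[n]addn0 iotaDl -map_comp.
Qed.

Lemma prefixS omega n :
  Defs.prefix omega n.+1 = rcons (Defs.prefix omega n) (omega n).
Proof. by rewrite -addn1 prefixD cats1 /= addn0. Qed.

Definition glue (v : seq bool) omega : nat -> bool :=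
  fun i => if (i < size v)%N then nth false v i else omega (i - size v)%N.

Lemma prefix_glue v omega : Defs.prefix (glue v omega) (size v) = v.
Proof.
apply: (@eq_from_nth _ false); rewrite size_prefix // => i iv.
rewrite (nth_map 0%N) ?size_iota // nth_iota // add0n /glue iv //.
Qed.

Lemma glueD v omega i : glue v omega (size v + i) = omega i.
Proof. by rewrite /glue ltnNge leq_addr /= addKn. Qed.

Lemma psum_cat b v w :
  psum lam b (v ++ w) = psum lam b v + lam ^+ size v * psum lam (fun u => b (v ++ u)) w.
Proof.
elim/last_ind: w => [|w i IH].
  by rewrite cats0 [X in _ * X]/psum big_ord0 mulr0 addr0.
rewrite -rcons_cat !psum_rcons IH rcons_cat size_cat mulrDr addrA.
by rewrite -addnS exprD; congr (_ + _); ring.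
Qed.

Lemma psum_prefix a t omega n :
  series (fun j : nat => (a (Defs.prefix omega j.+1) t)%:R * lam ^+ j.+1) n =
  psum lam (a ^~ t) (Defs.prefix omega n).
Proof.
elim: n => [|n IH]; first by rewrite /series /= big_geq // /psum big_ord0.
by rewrite seriesSr IH prefixS psum_rcons size_prefix.
Qed.

Hypothesis lam01 : 0 < lam < 1.
Hypothesis LE : L * (1 - lam) = lam.

Lemma L_gt0 : 0 < L.
Proof. have /andP[l0 l1] := lam01; have lE := LE; nra. Qed.

Lemma fbin_cvg a t omega :
  psum lam (a ^~ t) (Defs.prefix omega n) @[n --> \oo] --> fbin a lam t omega.
Proof.
have /andP[l0 _] := lam01.
rewrite -(eq_cvg _ _ (psum_prefix a t omega)) /fbin.
apply: nondecreasing_is_cvgn.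
  apply/nondecreasing_seqP => n; rewrite seriesSr lerDl.
  by rewrite mulr_ge0 // exprn_ge0 // ltW.
exists L => _ [n _ <-]; rewrite psum_prefix.
exact: psum_le.
Qed.

Lemma fbin_bounds a t omega : 0 <= fbin a lam t omega <= L.
Proof.
have c := @fbin_cvg a t omega.
rewrite -(cvg_lim _ c) //; apply/andP; split.
  apply: limr_ge; first by apply/cvg_ex; eexists; exact: c.
  by apply: nearW => n; exact: psum_ge0.
apply: limr_le; first by apply/cvg_ex; eexists; exact: c.
by apply: nearW => n; exact: psum_le.
Qed.

Lemma fbin_shift a t omega n : fbin a lam t omega =
  psum lam (a ^~ t) (Defs.prefix omega n) +
  lam ^+ n * fbin (fun u => a (Defs.prefix omega n ++ u)) lam t
    (fun i => omega (n + i)%N).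
Proof.
have c1 : psum lam (a ^~ t) (Defs.prefix omega (n + k)) @[k --> \oo] -->
    fbin a lam t omega.
  exact: (cvg_comp (addn n) (fun k => psum lam (a ^~ t) (Defs.prefix omega k))
    (@cvg_addnl n) (@fbin_cvg a t omega)).
have c2 := @fbin_cvg (fun u => a (Defs.prefix omega n ++ u)) t
  (fun i => omega (n + i)%N).
have c3 := cvgD (cvg_cst (psum lam (a ^~ t) (Defs.prefix omega n)))
  (cvgM (cvg_cst (lam ^+ n)) c2).
suff E : (fun k => psum lam (a ^~ t) (Defs.prefix omega (n + k))) =
    cst (psum lam (a ^~ t) (Defs.prefix omega n)) \+ (cst (lam ^+ n) \*
    (fun k => psum lam (fun u => a (Defs.prefix omega n ++ u) t)
      (Defs.prefix (fun i => omega (n + i)%N) k))).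
  by rewrite -(cvg_lim _ c1) // E; apply: cvg_lim => //; exact: c3.
by apply/funext => k /=; rewrite prefixD psum_cat size_prefix.
Qed.

Lemma fbin_glue a t v omega : fbin a lam t (glue v omega) =
  psum lam (a ^~ t) v +
  lam ^+ size v * fbin (fun u => a (v ++ u)) lam t omega.
Proof.
rewrite (fbin_shift _ _ _ (size v)) prefix_glue.
by congr (_ + _ * fbin _ _ _ _); apply/funext => i; rewrite glueD.
Qed.

Lemma fbin_prefix_close a t omega omega' n :
  Defs.prefix omega n = Defs.prefix omega' n ->
  `|fbin a lam t omega - fbin a lam t omega'| <= L * lam ^+ n.
Proof.
move=> E; rewrite (fbin_shift _ _ omega n) (fbin_shift _ _ omega' n) E.
set f := fbin _ _ _ _; set g := fbin _ _ _ _.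
have /andP[f0 f1] : 0 <= f <= L := fbin_bounds _ _ _.
have /andP[g0 g1] : 0 <= g <= L := fbin_bounds _ _ _.
have /andP[l0 _] := lam01; have p0 : 0 < lam ^+ n by rewrite exprn_gt0.
rewrite opprD addrACA subrr add0r -mulrBr normrM gtr0_norm // mulrC.
by rewrite ler_pM2r // ler_norml; apply/andP; split; lra.
Qed.

(* Koenig's lemma on the binary tree. *)
Lemma Sbin_approx a t x :
  (forall n, exists omega, `|x - fbin a lam t omega| <= lam ^+ n) ->
  Sbin a lam t x.
Proof.
move=> xS; have /andP[l0 l1] := lam01; have L0 := L_gt0.
(* A word is good if sums along its extensions come arbitrarily close to [x]. If both children
   failed, at precisions [n0] and [n1], precision [maxn n0 n1] would fail for the parent. *)
pose good v := forall n, exists2 omega, Defs.prefix omega (size v) = v &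
  `|x - fbin a lam t omega| <= lam ^+ n.
have good0 : good [::].
  by move=> n; case: (xS n) => w0 xo; exists w0.
have goodS v : exists i, good v -> good (rcons v i).
  apply: contrapT => /forallNP H.
  have [n0 h0] : exists n, forall omega,
      Defs.prefix omega (size v).+1 = rcons v false ->
      ~ `|x - fbin a lam t omega| <= lam ^+ n.
    have /not_implyP[_ /existsNP[n hn]] := H false; exists n => w0 pw xo.
    by apply: hn; exists w0 => //; rewrite size_rcons.
  have /not_implyP[gv /existsNP[n1 h1]] := H true.
  have [w0 pw xo] := gv (maxn n0 n1).
  case E : (w0 (size v)).
    apply: h1; exists w0; first by rewrite size_rcons prefixS pw E.
    by apply: le_trans xo _; rewrite ler_wiXn2l ?leq_maxr // ltW.
  apply: (h0 w0); first by rewrite prefixS pw E.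
  by apply: le_trans xo _; rewrite ler_wiXn2l ?leq_maxl // ltW.
have [nb nbP] := choice goodS.
pose w n := iter n (fun v => rcons v (nb v)) [::].
pose w0 n := nb (w n).
have wo n : Defs.prefix w0 n = w n.
  by elim: n => // n IH; rewrite prefixS IH.
have goodw n : good (w n) by elim: n => //= n IH; exact: nbP.
exists w0 => //; apply/eqP; rewrite eq_sym -subr_eq0 -normr_eq0.
apply: contrapT => /negP; rewrite normr_eq0 -normr_gt0 => x0.
have [n] := geometric_small (1 + L) lam01 x0; apply/negP; rewrite -leNgt.
have [w1 pw' xo'] := goodw n n.
have sw : size (w n) = n by rewrite -wo size_prefix.
rewrite sw -wo in pw'.
have := fbin_prefix_close a t pw'.
have := ler_normD (x - fbin a lam t w1) (fbin a lam t w1 - fbin a lam t w0).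
rewrite addrA subrK mulrDl mul1r; lra.
Qed.

Lemma Sbin_closed a t : closed (Sbin a lam t).
Proof.
move=> x xS; apply: Sbin_approx => n; have /andP[l0 _] := lam01.
have p0 : 0 < lam ^+ n by rewrite exprn_gt0.
have [_ [[w0 _ <-]]] := xS _ (nbhsx_ballx x _ p0).
by rewrite /ball /= => h; exists w0; rewrite ltW.
Qed.

(** A residual in [[0, L]] at [v] puts [x] within [L * lam ^ |v|] of every sum through [v]. The
    nodes need not be nested, because [Sbin_approx] accepts unrelated approximants. *)
Lemma Sbin_of_residual a t x :
  (forall N, exists2 v, (N <= size v)%N & 0 <= residual lam (a ^~ t) x v <= L) ->
  Sbin a lam t x.
Proof.
move=> H; apply: Sbin_approx => n; have /andP[l0 l1] := lam01.
have [N NL] := geometric_small L lam01 (exprn_gt0 n l0).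
have [v Nv /andP[r0 r1]] := H N.
pose w0 : nat -> bool := xpredT; exists (glue v w0); rewrite fbin_glue.
have p0 : 0 < lam ^+ size v by rewrite exprn_gt0.
have -> : x = psum lam (a ^~ t) v + lam ^+ size v * residual lam (a ^~ t) x v.
  by rewrite /residual; field; rewrite gt_eqF.
set f := fbin _ _ _ _; have /andP[f0 f1] : 0 <= f <= L := fbin_bounds _ _ _.
rewrite opprD addrACA subrr add0r -mulrBr normrM gtr0_norm //.
apply: le_trans (ltW NL); rewrite mulrC ler_pM ?normr_ge0 ?(ltW p0) //.
  by rewrite ler_norml; apply/andP; split; lra.
by rewrite ler_wiXn2l // ltW.
Qed.

Lemma interior_Sbin_cat a t v y :
  interior (Sbin (fun u => a (v ++ u)) lam t) y ->
  interior (Sbin a lam t) (psum lam (a ^~ t) v + lam ^+ size v * y).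
Proof.
have /andP[l0 l1] := lam01; have p0 : 0 < lam ^+ size v by rewrite exprn_gt0.
rewrite /interior /= -!nbhs_ballE => -[e /= e0 ye].
exists (lam ^+ size v * e); first by rewrite /= mulr_gt0.
move=> x; rewrite /ball /= => xy.
have [|w0 _ fo] := ye ((x - psum lam (a ^~ t) v) / lam ^+ size v).
  rewrite /ball /=.
  have -> : y - (x - psum lam (a ^~ t) v) / lam ^+ size v =
    (psum lam (a ^~ t) v + lam ^+ size v * y - x) / lam ^+ size v.
    by field; rewrite gt_eqF.
  by rewrite normrM [X in _ * X]gtr0_norm ?invr_gt0 // ltr_pdivrMr // [ltRHS]mulrC.
exists (glue v w0) => //; rewrite fbin_glue fo.
by field; rewrite gt_eqF.
Qed.

Lemma Sbin_regular a t :
  (forall v, interior (Sbin (fun u => a (v ++ u)) lam t) !=set0) ->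
  Sbin a lam t = closure (interior (Sbin a lam t)).
Proof.
move=> H; have /andP[l0 l1] := lam01.
apply/seteqP; split; last first.
  move=> x xS; apply: Sbin_closed => B /xS[y [Sy By]].
  by exists y; split => //; exact: interior_subset.
move=> _ [w0 _ <-] B; rewrite -nbhs_ballE => -[e /= e0 eB].
have [n ne] := geometric_small L lam01 e0.
have [y yS] := H (Defs.prefix w0 n).
have [w1 _ fo'] := interior_subset yS.
(* This is the sum along a path sharing [n] letters with [w0], hence within [L * lam ^+ n < e] of
   the given point. *)
exists (psum lam (a ^~ t) (Defs.prefix w0 n) + lam ^+ size (Defs.prefix w0 n) * y).
split; first exact: interior_Sbin_cat.
apply: eB; rewrite /ball /= -fo' -fbin_glue.
apply: le_lt_trans ne; apply: fbin_prefix_close.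
by rewrite -{3}(size_prefix w0 n) prefix_glue.
Qed.

End Support.

(** * Borel-Cantelli and propagation along the levels *)

Section Interior.
Variables (d : measure_display) (T : measurableType d) (R : realType).
Variables (P : probability T R) (a : seq bool -> T -> bool).
Hypothesis iid : iid_fair_labels P a.
Variables (lam L gam : R).
Hypothesis adm : admissible lam L gam.

(** The rate is that of [failure], the denominator that of [total_weight_start]. *)
Definition threshold n : R := (1 + gam / 8) ^+ n / (2 * (8 * L + 1)).

Definition mesh n : R := margin gam * lam ^+ n.

(** Enough points to cover [[0, 2 * L + 1]]: as [2 * lam > 1], the factor [2 ^ n] outweighs the
    [lam ^ n] in [mesh n]. *)
Definition mesh_size n : nat :=
  ((Num.truncn ((2 * L + 1) / margin gam)).+1 * 2 ^ n)%N.

Definition failures n : set T :=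
  \big[setU/set0]_(j < mesh_size n.+1)
    failure a lam L gam n (j%:R * mesh n.+1) (threshold n).

Lemma threshold_gt0 n : 0 < threshold n.
Proof.
have [lg g0 LE gl gL] := adm.
by rewrite divr_gt0 ?exprn_gt0 //; lra.
Qed.

Lemma prob_le_bigsetU N (F : nat -> set T) p :
  (forall j, prob_le P (F j) p) ->
  prob_le P (\big[setU/set0]_(j < N) F j) (N%:R * p).
Proof.
move=> Fp; elim: N => [|N [mN pN]].
  by rewrite big_ord0 mul0r; split=> //; rewrite measure0.
have [mF pF] := Fp N; rewrite big_ord_recr /=; split; first exact: measurableU.
apply: le_trans (measureU2 _ mN mF) _.
by rewrite -natr1 mulrDl mul1r EFinD leeD.
Qed.

(** Pick [k] with [q ^ k >= 4]; then [expR u >= (u / k) ^ k] at [u = c * q ^ n] is at least a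
    constant times [4 ^ n]. *)
Lemma expR_double_decay (q c : R) : 1 < q -> 0 < c ->
  exists C, forall n, 2 ^+ n * expR (- (c * q ^+ n)) <= C / 2 ^+ n.
Proof.
move=> q1 c0; have q0 : 0 < q by lra.
have qi : 0 < q^-1 < 1 by rewrite invr_gt0 q0 invf_lt1.
have e4 : 0 < 1 / 4 :> R by lra.
have [k] := geometric_small 1 qi e4; rewrite mul1r exprVn => kq.
have k0 : (0 < k)%N.
  by case: k kq => //; rewrite expr0 invr1 => ?; lra.
have kR : 0 < k%:R :> R by rewrite ltr0n.
have qk : 4 <= q ^+ k.
  by rewrite -[4]invrK -[leRHS]invrK lef_pV2 ?posrE ?invr_gt0 ?exprn_gt0 //; lra.
exists ((k%:R / c) ^+ k) => n; rewrite expRN.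
rewrite ler_pdivlMr ?exprn_gt0 // mulrAC ler_pdivrMr ?expR_gt0 //.
have -> : expR (c * q ^+ n) = expR (c * q ^+ n / k%:R) ^+ k.
  by rewrite -expRM_natl -mulr_natl; congr expR; field; rewrite gt_eqF.
rewrite -exprMn.
have -> : (2 * 2) ^+ n = (4 : R) ^+ n by congr (_ ^+ n); lra.
apply: le_trans (_ : (q ^+ k) ^+ n <= _).
  by apply: lerXn2r => //; rewrite nnegrE ?exprn_ge0 // ltW.
rewrite -exprMn exprAC; apply: lerXn2r; rewrite ?nnegrE ?exprn_ge0 ?(ltW q0) //.
  by rewrite mulr_ge0 ?expR_ge0 // divr_ge0 // ltW.
have {1}-> : q ^+ n = k%:R / c * (c * q ^+ n / k%:R).
  by field; rewrite !gt_eqF.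
rewrite ler_pM2l ?divr_gt0 //.
by have := expR_ge1Dx (c * q ^+ n / k%:R); lra.
Qed.

Lemma failures_prob_le n : prob_le P (failures n)
  ((mesh_size n.+1)%:R * expR (- (gam ^+ 2 / 512 * threshold n))).
Proof.
apply: (@prob_le_bigsetU _ (fun j => failure a lam L gam n (j%:R * mesh n.+1)
  (threshold n))) => j.
by apply: failure_prob_le => //; exact: ltW (threshold_gt0 n).
Qed.

Lemma failures_limsup : P (lim_sup_set failures) = 0%E.
Proof.
have [lg g0 LE gl gL] := adm.
apply: lim_sup_set_cvg0 => [n|]; first by have [] := failures_prob_le n.
have q1 : 1 < 1 + gam / 8 by lra.
have c0 : 0 < gam ^+ 2 / 512 / (2 * (8 * L + 1)).
  by apply: divr_gt0; [apply: divr_gt0; [exact: exprn_gt0|lra]|lra].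
have [C CP] := expR_double_decay q1 c0.
pose A : R := (Num.truncn ((2 * L + 1) / margin gam)).+1%:R.
apply: (@le_lt_trans _ _
    (\sum_(0 <= k <oo) (4 * A * C / (2 ^ (k + 1))%:R)%:E)%E).
  apply: lee_nneseries => [n _ _|n _]; first exact: measure_ge0.
  have [_ pn] := failures_prob_le n; apply: (le_trans pn); rewrite lee_fin.
  have -> : (mesh_size n.+1)%:R = 2 * A * 2 ^+ n :> R.
    by rewrite /mesh_size natrM natrX exprS -/A; ring.
  have -> : 4 * A * C / (2 ^ (n + 1))%:R = 2 * A * (C / 2 ^+ n).
    have : 2 ^+ n != 0 :> R by rewrite expf_neq0.
    by move=> h; rewrite natrX addn1 exprS; field; rewrite h.
  rewrite -mulrA ler_wpM2l ?mulr_ge0 //.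
  apply: le_trans (CP n); rewrite ler_pM2l ?exprn_gt0 // ler_expR lerN2.
  by rewrite /threshold mulrA mulrAC.
by rewrite (cvg_lim _ (@cvg_geometric_eseries_half R (4 * A * C) 0)) // ltry.
Qed.

Lemma margin_L : margin gam * L <= 1 / 16.
Proof.
have [lg g0 LE gl gL] := adm; have g8 := gam_le adm.
have h : gam * (4 * L) <= 1.
  have : (4 * gam) * L <= (1 - lam) * L by rewrite ler_wpM2r //; lra.
  lra.
rewrite /margin expr2.
have : gam * (gam * (4 * L)) <= gam * 1 by rewrite ler_wpM2l // ltW.
lra.
Qed.

Section Propagation.
Variables (t : T) (m : nat) (x0 : R).
Hypothesis no_failure : forall n, (m <= n)%N -> ~ failures n t.
Hypothesis x0_bounds : lam ^+ m * (L / 2) <= x0 <= 3 / 2 * L.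
Hypothesis start : forall x, `|x - x0| <= lam ^+ m / 8 ->
  threshold m <= total lam (weight lam L gam) (a ^~ t) m x.

(* Passing from a point to the nearest mesh point costs [mesh n.+1], and
   [mesh n.+1 = margin * L * lam ^ n - margin * L * lam ^ n.+1], so the radii
   below shrink by exactly that amount. *)
Lemma total_weight_propagation k x :
  `|x - x0| <= lam ^+ m / 16 + margin gam * L * lam ^+ (m + k) ->
  threshold (m + k) <= total lam (weight lam L gam) (a ^~ t) (m + k) x.
Proof.
have [lg g0 LE gl gL] := adm; have g8 := gam_le adm.
have lam01 : 0 < lam < 1 by apply/andP; split; lra.
have m0 := margin_gt0 adm; have mL := margin_L.
have l0 : 0 < lam by lra.
have p0 n : 0 < lam ^+ n by exact: exprn_gt0.
have mL0 : 0 <= margin gam * L by rewrite mulr_ge0 ?ltW //; lra.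
have le8 i : margin gam * L * lam ^+ (m + i) <= lam ^+ m / 16.
  have : lam ^+ (m + i) <= lam ^+ m by rewrite ler_wiXn2l ?leq_addr // ltW; lra.
  have := p0 (m + i)%N; have := p0 m.
  move=> *; apply: le_trans (_ : 1 / 16 * lam ^+ (m + i) <= _); last lra.
  by rewrite ler_wpM2r // ltW.
elim: k x => [|k IH] x xx0.
  rewrite addn0; apply: start; have := le8 0%N; move: xx0; rewrite addn0; lra.
have xr := le8 k.+1.
have {xr} : `|x - x0| <= lam ^+ m / 8 by lra.
rewrite ler_norml => /andP[xl xu]; have /andP[x0l x0u] := x0_bounds.
have lm1 : lam ^+ m <= 1 by rewrite exprn_ile1 //; lra.
have lmL : lam ^+ m * (1 / 2) <= lam ^+ m * (L / 2).
  by rewrite ler_pM2l //; lra.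
have x_ge0 : 0 <= x by have := p0 m; lra.
have x_le : x <= 2 * L + 1 by lra.
have h0 : 0 < mesh (m + k).+1 by rewrite mulr_gt0.
(* The mesh point just left of [x]; the bounds on [x0] keep [x] inside the range covered by the
   mesh. *)
pose j := Num.truncn (x / mesh (m + k).+1).
have xh0 : 0 <= x / mesh (m + k).+1 by rewrite divr_ge0 // ltW.
have /andP[jl ju] : j%:R <= x / mesh (m + k).+1 < j.+1%:R by exact: truncn_itv.
rewrite ler_pdivlMr // in jl; rewrite ltr_pdivrMr // -natr1 mulrDl mul1r in ju.
have jlt : (j < mesh_size (m + k).+1)%N.
  rewrite -(ltr_nat R); apply: (@le_lt_trans _ _ (x / mesh (m + k).+1)).
    by rewrite ler_pdivlMr.
  rewrite ltr_pdivrMr // /mesh_size natrM natrX.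
  have : (2 * L + 1) / margin gam <
      (Num.truncn ((2 * L + 1) / margin gam)).+1%:R by exact: truncnS_gt.
  rewrite ltr_pdivrMr // => hA.
  set A := _.+1%:R in hA *; apply: (le_lt_trans x_le); apply: (lt_le_trans hA).
  rewrite /mesh -mulrA ler_wpM2l ?ler0n //.
  rewrite mulrCA ler_peMr ?(ltW m0) // -exprMn exprn_ege1 //; lra.
rewrite addnS.
have xj : `|x - j%:R * mesh (m + k).+1| <= mesh (m + k).+1.
  by rewrite ger0_norm; lra.
have rE : margin gam * L * lam ^+ (m + k) =
    margin gam * L * lam ^+ (m + k).+1 + mesh (m + k).+1.
  have LE2 : L = L * lam + lam by lra.
  by rewrite /mesh exprS {1}LE2; ring.
have hj : threshold (m + k) <=
    total lam (weight lam L gam) (a ^~ t) (m + k) (j%:R * mesh (m + k).+1).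
  apply: IH; rewrite rE; apply: le_trans (ler_distD x _ _) _.
  by rewrite distrC; move: xx0; rewrite addnS; lra.
have nf : ~ failure a lam L gam (m + k) (j%:R * mesh (m + k).+1) (threshold (m + k)) t.
  move=> jf; apply: (no_failure (leq_addr k m)).
  rewrite /failures -(@bigcup_mkord _ _ (fun i => failure a lam L gam (m + k)
    (i%:R * mesh (m + k).+1) (threshold (m + k)))).
  by exists j.
have : threshold (m + k).+1 <=
    total lam (inner_weight lam L gam) (a ^~ t) (m + k).+1 (j%:R * mesh (m + k).+1).
  rewrite leNgt; apply/negP => h; apply: nf; split=> //.
  by move: h; rewrite /threshold exprS -mulrA.
move=> /le_trans; apply.
apply: (@total_le _ _ lam01 _ _ _ _ _ _ _ (inner_weight_le adm)).
by rewrite distrC.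
Qed.

(** Throughout the ball of radius [lam ^+ m / 16] the total weight is positive at every level from
    [m] on, so each such level has a node with residual in [[0, L]]. *)
Lemma interior_Sbin_propagation : interior (Sbin a lam t) x0.
Proof.
have [lg g0 LE gl gL] := adm.
have lam01 : 0 < lam < 1 by apply/andP; split; lra.
rewrite /interior /= -nbhs_ballE; exists (lam ^+ m / 16) => /=.
  by rewrite divr_gt0 // exprn_gt0 //; lra.
move=> x; rewrite /ball /= distrC => xx0.
apply: (Sbin_of_residual lam01 LE) => N.
have : threshold (m + N) <= total lam (weight lam L gam) (a ^~ t) (m + N) x.
  apply: total_weight_propagation; apply: le_trans (ltW xx0) _.
  rewrite lerDl !mulr_ge0 ?(ltW (margin_gt0 adm)) ?exprn_ge0 //; lra.
move=> /(lt_le_trans (threshold_gt0 _)) tw.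
have [v vw wv] : exists2 v, v \in words (m + N) &
    0 < weight lam L gam (residual lam (a ^~ t) x v).
  apply: contrapT => H; move: tw; apply/negP; rewrite -leNgt /total big_seq.
  apply: sumr_le0 => v vw; rewrite leNgt; apply/negP => wv.
  by apply: H; exists v.
exists v; first by move: vw; rewrite mem_words => /eqP ->; rewrite leq_addl.
exact: weight_gt0_bounds wv.
Qed.

End Propagation.

Lemma ae_interior_Sbin : {ae P, forall t, interior (Sbin a lam t) !=set0}.
Proof.
have [lg g0 LE gl gL] := adm.
exists (lim_sup_set failures); split; last 1 first.
- move=> t /= nt m _; apply: contrapT => H; apply: nt.
  have [x0 x0b st] := total_weight_start adm (a ^~ t) m.
  exists x0; apply: (@interior_Sbin_propagation t m x0) => // [n mn fn|x xx0].
    by apply: H; exists n.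
  apply: le_trans (st x xx0); rewrite /threshold ler_pM2r ?invr_gt0 //; last lra.
  have g8 := gam_le adm.
  (* This makes the initial growth rate [2 * lam] at least the threshold rate [1 + gam / 8]. *)
  have l35 : 3 / 5 <= lam.
    have : (1 + lam) * (1 - lam) <= L * (1 - lam) by rewrite ler_wpM2r //; lra.
    by rewrite LE; nra.
  by apply: lerXn2r; rewrite ?nnegrE; lra.
- apply: bigcap_measurable => // n _; apply: bigcup_measurable => k _.
  by have [] := failures_prob_le k.
- exact: failures_limsup.
Qed.

End Interior.

(** * The golden-mean condition and the passage to all subtrees *)

Theorem theorem1p7 (d : measure_display) (T : measurableType d) (R : realType)
    (P : probability T R) (a : seq bool -> T -> bool) (lambda : R) :
  iid_fair_labels P a ->
  (Num.sqrt 5 - 1) / 2 < lambda < 1 ->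
  {ae P, forall t, interior (Sbin a lambda t) !=set0 /\
                   Sbin a lambda t = closure (interior (Sbin a lambda t))}.
Proof.
move=> iid /andP[lg l1].
have l2 : 1 < lambda + lambda * lambda.
  have s0 : 0 <= Num.sqrt 5 :> R by exact: sqrtr_ge0.
  have s2 : Num.sqrt 5 * Num.sqrt 5 = 5 :> R by rewrite -expr2 sqr_sqrtr.
  have : Num.sqrt 5 < 2 * lambda + 1 by lra.
  have s1 : 1 < Num.sqrt 5 :> R by nra.
  nra.
have lam01 : 0 < lambda < 1.
  by rewrite l1 andbT; have := sqrtr_ge0 (5 : R); nra.
pose L := lambda / (1 - lambda).
have LE : L * (1 - lambda) = lambda by rewrite /L divfK //; lra.
have LgE : 1 + lambda < L by rewrite /L ltr_pdivlMr; nra.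
pose gam := Num.min (1 - lambda) (L - 1 - lambda) / 4.
have adm : admissible lambda L gam.
  have h1 : Num.min (1 - lambda) (L - 1 - lambda) <= 1 - lambda by rewrite ge_min lexx.
  have h2 : Num.min (1 - lambda) (L - 1 - lambda) <= L - 1 - lambda.
    by rewrite ge_min lexx orbT.
  split; rewrite /gam //; [nra| |lra|lra].
  by rewrite divr_gt0 // lt_min; apply/andP; split; lra.
(* The labels below [v] form another copy of the model; patterns are transported by stripping the
   prefix [v]. *)
have iid_cat v : iid_fair_labels P (fun u => a (v ++ u)).
  split=> [u|s b us ss]; first exact: iid.1.
  have := iid.2 [seq v ++ u | u <- s] (fun w => b (drop (size v) w)).
  rewrite map_inj_uniq ?us; last by move=> x y /eqP; rewrite eqseq_cat // eqxx => /eqP.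
  rewrite all_map size_map => <- //; last first.
    by apply/allP => u /(allP ss) /= u0; rewrite size_cat ltn_addl.
  congr (P _); apply/seteqP; split=> t H /=.
    by move=> _ /mapP[u us' ->] /=; rewrite drop_size_cat //; exact: H.
  by move=> u us' /=; have /= := H (v ++ u); rewrite drop_size_cat //; apply; exact: map_f.
(* Words are countable, so enumerating them by [unpickle] gives one null set for all subtrees. *)
have : \forall t \ae P, forall n,
    interior (Sbin (fun u => a (odflt [::] (unpickle n) ++ u)) lambda t) !=set0.
  by apply: ae_foralln => n; exact: (ae_interior_Sbin (iid_cat _) adm).
apply: filterS => t H.
have Hv v : interior (Sbin (fun u => a (v ++ u)) lambda t) !=set0.
  by have := H (pickle v); rewrite pickleK.
by split; [exact: (Hv [::])|exact: (Sbin_regular lam01 LE)].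
Qed.
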